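(* Let $\bar{A}\in\{0,\star\}^{n\times n}$ be a symmetrically structured matrix and let $\mathcal{T}=\{i_1,\dots,i_k\}\subseteq[n]$ (with $|\mathcal{T}|=k$). Let $\mathcal{D}(\bar{A})=(\mathcal{X},\mathcal{E}_{\mathcal{X},\mathcal{X}})$ be the digraph representation of $\bar{A}$, let $\mathcal{X}_{\mathcal{T}}=\{x_i:i\in\mathcal{T}\}\subseteq\mathcal{X}$, and let $C_{\mathcal{T}}\in\mathbb{R}^{k\times n}$ be defined by $[C_{\mathcal{T}}]_{\ell j}=1$ if $j=i_\ell$ and $0$ otherwise. Then the generic rank of $C_{\mathcal{T}}\bar{A}$ equals $k$ if and only if $|\mathcal{N}(\mathcal{S})|\ge|\mathcal{S}|$ for all $\mathcal{S}\subseteq\mathcal{X}_{\mathcal{T}}$.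
   Context: $[n]=\{1,\dots,n\}$. A symmetrically structured matrix $\bar{A}\in\{0,\star\}^{n\times n}$ is a matrix each of whose entries is a fixed zero or a free real parameter $\star$, such that $[\bar{A}]_{ij}=\star$ if and only if $[\bar{A}]_{ji}=\star$, where the parameter at $(i,j)$ is constrained to take the same value as the one at $(j,i)$ and the parameters are otherwise independent. A numerical realization $\tilde{A}$ of $\bar{A}$ is obtained by assigning real numbers to the independent free parameters (so $\tilde{A}$ is real symmetric). The generic rank of $C_{\mathcal{T}}\bar{A}$ is the maximum of $\mathrm{rank}(C_{\mathcal{T}}\tilde{A})$ over all numerical realizations $\tilde{A}$ of $\bar{A}$. The digraph $\mathcal{D}(\bar{A})$ has vertex set $\mathcal{X}=\{x_1,\dots,x_n\}$ and edge set $\mathcal{E}_{\mathcal{X},\mathcal{X}}=\{(x_j,x_i):[\bar{A}]_{ij}=\star\}$. For $\mathcal{S}\subseteq\mathcal{X}$, $\mathcal{N}(\mathcal{S})=\{v\in\mathcal{X}:(v,w)\in\mathcal{E}_{\mathcal{X},\mathcal{X}}\text{ for some }w\in\mathcal{S}\}$ is the in-neighbour set. *)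

(* Defs.v *)
From mathcomp Require Import all_boot all_order all_algebra.
From mathcomp Require Import boolp reals.

Set Implicit Arguments.
Unset Strict Implicit.
Unset Printing Implicit Defensive.

Import GRing.Theory.
Local Open Scope ring_scope.

(* A {0,*}-pattern is a boolean matrix: [true] is a free parameter, [false] a
   fixed zero. *)
Definition symm_structured (n : nat) (Abar : 'M[bool]_n) : Prop :=
  forall i j : 'I_n, Abar i j <-> Abar j i.

(* The free parameters are indexed by unordered pairs {i, j} (singletons on the
   diagonal), so that positions (i, j) and (j, i) share one parameter and there
   is no other dependency; values of [p] at other sets are irrelevant. *)
Definition realize (R : realType) (n : nat) (Abar : 'M[bool]_n)
    (p : {set 'I_n} -> R) : 'M[R]_n :=
  \matrix_(i, j) if Abar i j then p [set i; j] else 0.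

Definition numerical_realization (R : realType) (n : nat)
    (Abar : 'M[bool]_n) (A : 'M[R]_n) : Prop :=
  exists p : {set 'I_n} -> R, A = realize Abar p.

(* The range r < k.+1 loses nothing, since C *m A has k rows; see
   [generic_rankP]. *)
Definition generic_rank (R : realType) (k n : nat) (C : 'M[R]_(k, n))
    (Abar : 'M[bool]_n) : nat :=
  \max_(r < k.+1 | `[< exists2 A : 'M[R]_n,
      numerical_realization Abar A & \rank (C *m A) = r >]) r.

Lemma generic_rankP (R : realType) (k n : nat) (C : 'M[R]_(k, n))
    (Abar : 'M[bool]_n) :
  (exists2 A : 'M[R]_n, numerical_realization Abar A &
     \rank (C *m A) = generic_rank C Abar) /\
  (forall A : 'M[R]_n, numerical_realization Abar A ->
     (\rank (C *m A) <= generic_rank C Abar)%N).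
Proof.
have ub (A : 'M[R]_n) : numerical_realization Abar A ->
    (\rank (C *m A) <= generic_rank C Abar)%N.
  move=> hA; have lt_r : (\rank (C *m A) < k.+1)%N.
    by rewrite ltnS rank_leq_row.
  rewrite /generic_rank.
  apply: (@leq_bigmax_cond _ _ (fun r : 'I_k.+1 => r : nat) (Ordinal lt_r)).
  by apply/asboolP; exists A.
split=> //; pose A0 : 'M[R]_n := realize Abar (fun=> 0).
have hA0 : numerical_realization Abar A0 by exists (fun=> 0).
have lt0 : (\rank (C *m A0) < k.+1)%N by rewrite ltnS rank_leq_row.
rewrite /generic_rank.
rewrite (@bigop.bigmax_eq_arg _ (Ordinal lt0)); last first.
  by apply/asboolP; exists A0.
case: arg_maxnP => [|r /asboolP[A hA rA] _]; last by exists A.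
by apply/asboolP; exists A0.
Qed.

(* The vertex x_i is identified with its index i, and a digraph with its set of
   edges (tail, head).  Note the transposition: (x_j, x_i) is an edge iff
   [Abar i j]. *)
Definition digraph (n : nat) (Abar : 'M[bool]_n) : {set 'I_n * 'I_n} :=
  [set e | Abar e.2 e.1].

Definition in_neighbours (n : nat) (E : {set 'I_n * 'I_n}) (S : {set 'I_n}) :
    {set 'I_n} :=
  [set v | [exists w in S, (v, w) \in E]].

Definition selection_mx (R : realType) (k n : nat) (t : 'I_k -> 'I_n) :
    'M[R]_(k, n) :=
  \matrix_(l, j) (if j == t l then 1 else 0).
Arguments selection_mx R {k n} t.

(* Main.v *)
(* Necessity: the rows indexed by S vanish outside the columns N(S).
   Sufficiency: a matching of T into its neighbours (Hall) extends to a permutation s.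
   With B the matrix having W x at (x, s x) and zeros elsewhere, where W vanishes
   off T, the symmetric matrix A = B + B^T realizes the pattern.  A row vector u
   supported in T and killed by A satisfies W x u x = - W (s x) u (s (s x)) for
   all x; a nonzero entry of u then propagates, so its whole s-cycle lies in T.
   If the s^2-orbit of x is the whole cycle, W y u y u (s y) changes sign at each
   step but returns to its value, so it is 0.  Otherwise the cycle splits into
   two s^2-orbits, and the product of the equations over one of them forces the
   products of W over both to agree up to sign, which fails when W is 2 at one
   vertex of each cycle and 1 at the others. *)
Require Import Defs.
From mathcomp Require Import all_boot all_order all_algebra.
From mathcomp Require Import perm zify ring.
From mathcomp Require Import boolp reals.

Set Implicit Arguments.
Unset Strict Implicit.
Unset Printing Implicit Defensive.

(** Rado's argument: as long as some [F i] has two elements, one of them can be discarded without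
    breaking Hall's condition; once every [F i] is a singleton, the matching is forced. The
    induction is on the total size of the sets. *)
Lemma hall_marriage (I J : finType) (F : I -> {set J}) :
  (forall S : {set I}, #|S| <= #|\bigcup_(i in S) F i|) ->
  exists2 f : I -> J, injective f & forall i, f i \in F i.
Proof.
have [m le_m] := ubnP (\sum_i #|F i|).
elim: m F le_m => // m IHm F le_m hallF.
have F_gt0 i : 0 < #|F i| by have := hallF [set i]; rewrite cards1 big_set1.
have [/existsP[i /card_gt1P[a [b [Fa Fb neq_ab]]]] | F_le1] :=
  boolP [exists i, 1 < #|F i|]; last first.
  have /fin_all_exists[f fE] i : exists x, F i = [set x].
    apply/cards1P; rewrite eqn_leq F_gt0 andbT leqNgt.
    by rewrite negb_exists in F_le1; apply: (forallP F_le1).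
  exists f => [i j eq_f | i]; last by rewrite fE set11.
  apply/eqP/negPn/negP=> neq_ij.
  have := hallF [set i; j].
  by rewrite cards2 neq_ij bigcup_setU !big_set1 !fE eq_f setUid cards1.
pose G c k := if k == i then F i :\ c else F k.
have GF c k : G c k \subset F k.
  by rewrite /G; case: eqP => [->|_] //; apply: subD1set.
have FG c k : k != i -> G c k = F k by rewrite /G => /negbTE->.
have [c /andP[Fc /forallP hallG] | bad] :=
    pickP [pred c | (c \in F i) &&
      [forall S : {set I}, #|S| <= #|\bigcup_(k in S) G c k|]].
  have ltG : \sum_k #|G c k| < m.
    rewrite -ltnS; apply: leq_trans le_m; rewrite ltnS.
    rewrite (bigD1 i) // [X in _ < X](bigD1 i) //=.
    rewrite -addSn leq_add //.
      by rewrite /G eqxx [X in _ < X](cardsD1 c) Fc.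
    by apply: leq_sum => k _; apply: subset_leq_card.
  have [f f_inj fG] := IHm (G c) ltG hallG.
  by exists f => // k; apply: subsetP (fG k).
have {}bad c : c \in F i ->
    exists2 S : {set I}, i \in S & #|\bigcup_(k in S) G c k| < #|S|.
  move=> Fc; have /= := bad c; rewrite Fc => /negbT.
  rewrite negb_forall => /existsP[S]; rewrite -ltnNge => ltS.
  exists S => //; apply: contraLR ltS => iS; rewrite -leqNgt.
  rewrite (eq_bigr F) // => k kS; apply: FG.
  by apply: contraNneq iS => <-.
(* Submodularity: the two violating sets, glued along [i], contradict Hall. *)
have [[Sa iSa ltSa] [Sb iSb ltSb]] := (bad a Fa, bad b Fb).
set Ua := \bigcup_(k in Sa) _ in ltSa; set Ub := \bigcup_(k in Sb) _ in ltSb.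
have leU : #|Sa :|: Sb| <= #|Ua :|: Ub|.
  apply: leq_trans (hallF _) _; apply: subset_leq_card.
  apply/bigcupsP=> k; rewrite inE => kS; apply/subsetP=> x.
  have [-> Fx | neq_ki Fx] := eqVneq k i.
    (* The only element of [F i] missing from [G a i] is [a], and it survives in [G b i]. *)
    rewrite inE; have [xa | neq_xa] := eqVneq x a.
      apply/orP; right; apply/bigcupP; exists i => //.
      by rewrite /G eqxx !inE Fx xa neq_ab.
    apply/orP; left; apply/bigcupP; exists i => //.
    by rewrite /G eqxx !inE Fx neq_xa.
  by rewrite inE; case/orP: kS => kS; apply/orP; [left | right];
    apply/bigcupP; exists k; rewrite // FG.
have leI : #|(Sa :&: Sb) :\ i| <= #|Ua :&: Ub|.
  apply: leq_trans (hallF _) _; apply: subset_leq_card.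
  apply/bigcupsP=> k; rewrite !inE => /and3P[neq_ki ka kb]; apply/subsetP=> x Fx.
  by rewrite inE; apply/andP; split; apply/bigcupP; exists k; rewrite // FG.
(* The intersection lost only [i], so |Sa| + |Sb| <= |Ua| + |Ub| + 1, whereas the two violations
   give |Ua| + |Ub| + 2 <= |Sa| + |Sb|. *)
have := cardsD1 i (Sa :&: Sb); rewrite !inE iSa iSb /=.
have := cardsUI Sa Sb; have := cardsUI Ua Ub; lia.
Qed.

Import Order.TTheory GRing.Theory Num.Theory.
Local Open Scope ring_scope.

(** The pick depends only on the set [porbit s x], which all points of a cycle share, so each cycle
    has exactly one root. *)
Definition is_cycle_root (I : finType) (s : {perm I}) (x : I) :=
  [pick y in porbit s x] == Some x.

Lemma porbit_root (I : finType) (s : {perm I}) (x : I) :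
  exists2 r, r \in porbit s x &
    forall y, y \in porbit s x -> is_cycle_root s y = (y == r).
Proof.
have [r r_x pick_r] : exists2 r, r \in porbit s x & [pick y in porbit s x] = Some r.
  by case: pickP => [r | /(_ x)]; [exists r | rewrite porbit_id].
exists r => // y; rewrite -eq_porbit_mem => /eqP eq_y.
by rewrite /is_cycle_root eq_y pick_r eq_sym.
Qed.

Definition cycle_weight (F : realFieldType) (I : finType)
    (T : {set I}) (s : {perm I}) (x : I) : F :=
  if x \in T then (if is_cycle_root s x then 2 else 1) else 0.

(** The second hypothesis is column [s x] of the equation u (B + B^T) = 0. *)
Lemma cycle_weight_inj (F : realFieldType) (I : finType)
    (T : {set I}) (s : {perm I}) (u : I -> F) :
  (forall x, x \notin T -> u x = 0) ->
  (forall x, u x * cycle_weight F T s x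
             + cycle_weight F T s (s x) * u (s (s x)) = 0) ->
  forall x, u x = 0.
Proof.
set W := cycle_weight F T s => uT uE x; apply/eqP/negPn/negP=> ux.
have WT y : (W y != 0) = (y \in T).
  by rewrite /W /cycle_weight; case: ifP => _; rewrite ?eqxx //;
    case: ifP => _; rewrite ?oner_eq0 ?pnatr_eq0.
have uNT y : u y != 0 -> y \in T by apply: contraNT => /uT->.
have uE' y : W (s y) * u (s (s y)) = - (u y * W y).
  by apply/eqP; rewrite -addr_eq0 addrC uE.
have step y : u y != 0 -> (s y \in T) && (u (s (s y)) != 0).
  move=> uy; rewrite -WT -negb_or -mulf_eq0 uE' oppr_eq0 mulf_neq0 //.
  by rewrite WT uNT.
pose s2 := (s * s)%g; pose O := porbit s2 x.
have s2E i y : (s2 ^+ i)%g y = iter i.*2 s y.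
  elim: i y => [|i IHi] y; first by rewrite perm1.
  by rewrite expgS !permM IHi doubleS !iterSr.
have uO y : y \in O -> u y != 0.
  case/porbitP=> i ->; elim: i => [|i IHi]; first by rewrite perm1.
  by rewrite expgSr !permM; case/andP: (step _ IHi).
have OS y : (s (s y) \in O) = (y \in O).
  have := porbit_perm s2 1 y; rewrite expg1 permM => eqO.
  by rewrite -!eq_porbit_mem eqO.
pose q y := u y * u (s y) * W y.
have qS y : q (s y) = - q y.
  by rewrite /q -mulrA [_ * W (s y)]mulrC uE'; ring.
have q_even i y : q (iter i.*2 s y) = q y.
  by elim: i => // i IHi; rewrite doubleS !iterS !qS opprK.
(* Odd cycle: [s x] is an even iterate of [x], so [q x = - q x], although all three factors of [q x]
   are nonzero. *)
have [sxO | sxO] := boolP (s x \in O).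
  have /porbitP[i] := sxO; rewrite s2E => sxE.
  have /eqP := qS x; rewrite sxE q_even -addr_eq0 -mulr2n mulrn_eq0 /= /q !mulf_eq0.
  by rewrite (negbTE (uO _ sxO)) (negbTE ux) -[W x == 0]negbK WT uNT.
have SO y : y \in O -> s y \notin O.
  case/porbitP=> i ->; rewrite s2E -iterS iterSr -s2E.
  by rewrite -eq_porbit_mem porbit_perm eq_porbit_mem.
(* Multiply [uE'] over [O] in absolute value, which removes the signs. Since [s2] permutes [O], the
   same product of [|u y|] appears on both sides and cancels. *)
have prodW : \prod_(y in O) W y = \prod_(y in O) W (s y).
  have produ : \prod_(y in O) `|u y| != 0.
    by apply/prodf_neq0 => y yO; rewrite normr_eq0 uO.
  have W_ge0 y : 0 <= W y by rewrite /W /cycle_weight; do 2?case: ifP.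
  apply: (mulIf produ).
  rewrite [X in _ = _ * X](reindex_inj (@perm_inj _ s2)) /=.
  rewrite (eq_bigl (mem O) (fun y => `|u (s2 y)|)) => [|y]; last first.
    by rewrite permM OS.
  rewrite -!big_split; apply: eq_bigr => y _ /=; rewrite permM.
  rewrite -[W y]ger0_norm // -[W (s y)]ger0_norm // -!normrM uE' normrN.
  by rewrite mulrC.
have OT y : y \in O -> (y \in T) && (s y \in T).
  by move=> /uO uy; rewrite uNT //; case/andP: (step _ uy).
have sub_O y : y \in O -> (y \in porbit s x) && (s y \in porbit s x).
  by case/porbitP=> i ->; rewrite s2E -iterS -!permX !mem_porbit.
have [r r_x rootE] := porbit_root s x.
have WE y : y \in O ->
    W y = (if y == r then 2 else 1) /\ W (s y) = (if s y == r then 2 else 1).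
  move=> yO; have /andP[yT syT] := OT _ yO; have /andP[yx syx] := sub_O _ yO.
  by rewrite /W /cycle_weight yT syT !rootE.
have two_neq_one : (2 == 1 :> F) = false by apply: etrans (eqr_nat F 2 1) _.
(* The root lies in exactly one of [O] and its image under [s], so one of the two products is 2 and
   the other is 1. *)
move: prodW; have [r_O | r_nO] := boolP (r \in O).
  rewrite [X in _ = X]big1 => [|y yO]; last first.
    by rewrite (WE y yO).2; case: eqP (SO y yO) => // ->; rewrite r_O.
  rewrite (bigD1 r) //= (WE r r_O).1 eqxx big1 => [|y /andP[yO /negbTE neq_yr]].
    by rewrite mulr1 => /eqP; rewrite two_neq_one.
  by rewrite (WE y yO).1 neq_yr.
rewrite big1 => [|y yO]; last first.
  by rewrite (WE y yO).1; case: eqP yO => // ->; rewrite (negbTE r_nO).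
(* An even iterate of [x] would lie in [O], so [r] is an odd iterate and its predecessor an even
   one. *)
have r'_O : (s^-1)%g r \in O.
  have /porbitP[i rE] := r_x; move: r_nO; rewrite rE permX.
  rewrite -(odd_double_half i); case: (odd i); last first.
    by rewrite add0n -s2E mem_porbit.
  by rewrite /= permK -s2E mem_porbit.
rewrite (bigD1 _ r'_O) /= (WE _ r'_O).2 permKV eqxx big1 => [|y /andP[yO neq_yr]].
  by rewrite mulr1 => /esym/eqP; rewrite two_neq_one.
by rewrite (WE y yO).2 (can2_eq (permK s) (permKV s)) (negbTE neq_yr).
Qed.

(** The matrix factors through its columns indexed by [N]. *)
Lemma rank_support_cols (F : fieldType) (m n : nat) (M : 'M[F]_(m, n))
    (N : {set 'I_n}) :
  (forall i j, j \notin N -> M i j = 0) -> (\rank M <= #|N|)%N.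
Proof.
move=> M0; pose e (i : 'I_#|N|) : 'I_n := enum_val i.
suff -> : M = colsub e M *m rowsub e 1%:M by apply: mulmx_max_rank.
apply/matrixP=> i j; rewrite mxE.
rewrite (eq_bigr (fun l => M i (e l) * (e l == j)%:R)) => [|l _]; last first.
  by rewrite !mxE.
rewrite -(big_enum_val (fun x => M i x * (x == j)%:R)) /=.
have [jN | jN] := boolP (j \in N).
  rewrite (bigD1 j) //= eqxx mulr1 big1 ?addr0 // => l /andP[_ /negbTE->].
  by rewrite mulr0.
rewrite M0 // big1 // => l lN; case: eqP lN => [->|_ _]; last by rewrite mulr0.
by rewrite (negbTE jN).
Qed.

Lemma row_free_rowsub (F : fieldType) (m p n : nat) (M : 'M[F]_(m, n))
    (f : 'I_p -> 'I_m) :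
  injective f -> row_free M -> row_free (rowsub f M).
Proof.
move=> f_inj Mfree; rewrite -row_leq_rank rowsubE mxrankMfree // row_leq_rank.
apply/row_freeP; exists (rowsub f 1%:M)^T; apply/matrixP=> i j.
rewrite !mxE (bigD1 (f i)) //= !mxE eqxx mul1r (inj_eq f_inj) eq_sym.
rewrite big1 ?addr0 // => l /negbTE neq_l.
by rewrite !mxE eq_sym neq_l mul0r.
Qed.

(** The parameter of an unordered pair is read off at an arbitrary ordering of it; symmetry makes
    the choice harmless. Sets that are not of the form {a, b} get the default 0. *)
Lemma symmetric_numerical_realization (R : realType) (n : nat)
    (Abar : 'M[bool]_n) (A : 'M[R]_n) :
  A^T = A -> (forall i j, ~~ Abar i j -> A i j = 0) ->
  numerical_realization Abar A.
Proof.
move=> symA A0.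
pose p (S : {set 'I_n}) :=
  if [pick e : 'I_n * 'I_n | S == [set e.1; e.2]] is Some e then A e.1 e.2 else 0.
exists p; apply/matrixP=> i j; rewrite mxE.
case: ifPn => [_ | /A0//]; rewrite /p.
case: pickP => [[a b] /= /eqP eq_ij | /(_ (i, j))]; last by rewrite eqxx.
have symE x y : A x y = A y x by rewrite -[in LHS]symA mxE.
have /set2P ia : i \in [set a; b] by rewrite -eq_ij set21.
have /set2P jb : j \in [set a; b] by rewrite -eq_ij set22.
have /set2P ai : a \in [set i; j] by rewrite eq_ij set21.
have /set2P bj : b \in [set i; j] by rewrite eq_ij set22.
case: ia jb ai bj => -> [->|->] ai bj //; [by case: bj => -> | by case: ai => ->].
Qed.

Lemma mul_selection_mx (R : realType) (k n m : nat) (t : 'I_k -> 'I_n)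
    (A : 'M[R]_(n, m)) :
  selection_mx R t *m A = rowsub t A.
Proof.
rewrite rowsubE; congr (_ *m A); apply/matrixP=> l j; rewrite !mxE eq_sym.
by case: eqP.
Qed.

Local Close Scope ring_scope.

Theorem lemma1 (R : realType) (n k : nat) (Abar : 'M[bool]_n)
    (hA : symm_structured Abar)
    (T : {set 'I_n}) (t : 'I_k -> 'I_n)
    (hT : T = [set t l | l : 'I_k]) (hk : #|T| = k) :
  generic_rank (selection_mx R t) Abar = k <->
  (forall S : {set 'I_n}, S \subset T ->
     #|S| <= #|in_neighbours (digraph Abar) S|).
Proof.
have t_inj : injective t.
  have /imset_injP tP : #|[set t l | l : 'I_k]| == #|'I_k|.
    by rewrite -hT hk card_ord.
  by move=> l l'; apply: tP.
have nbrE (S : {set 'I_n}) v :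
    reflect (exists2 w, w \in S & Abar w v) (v \in in_neighbours (digraph Abar) S).
  rewrite inE; apply: (iffP exists_inP) => -[w wS]; rewrite ?inE => vw;
  by exists w; rewrite ?inE.
have [[A0 A0real rkA0] rk_max] := generic_rankP (selection_mx R t) Abar.
split=> [rk_k S sST | hall].
  pose K := t @^-1: S; pose f (l : 'I_#|K|) : 'I_k := enum_val l.
  have cardK : #|K| = #|S|.
    rewrite -(card_imset _ t_inj); apply: eq_card => x.
    apply/imsetP/idP => [[l lK ->] | xS]; first by rewrite inE in lK.
    have := subsetP sST _ xS; rewrite hT => /imsetP[l _ xE].
    by exists l; rewrite // inE -xE.
  have A0free : row_free (rowsub t A0).
    by rewrite -row_leq_rank -mul_selection_mx rkA0 rk_k.
  have := row_free_rowsub (@enum_val_inj _ K) A0free.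
  rewrite -row_leq_rank -cardK => /leq_trans; apply.
  apply: rank_support_cols => l j jN; case: A0real => p ->.
  rewrite !mxE; case: ifP => // Aj; case/nbrE: jN; exists (t (f l)) => //.
  by have := enum_valP l; rewrite inE.
(* Off [T] every value is allowed: Hall's condition is then trivial for [S] not inside [T], and the
   matching is an injection of the whole index set into itself, hence a permutation. *)
pose F i := if i \in T then in_neighbours (digraph Abar) [set i] else setT.
have [|f f_inj fF] := @hall_marriage _ _ F.
  move=> S; have [sST | /subsetPn[i iS iT]] := boolP (S \subset T).
    apply: leq_trans (hall S sST) _; apply/subset_leq_card/subsetP=> v.
    case/nbrE=> w wS Awv; apply/bigcupP; exists w => //.
    by rewrite /F (subsetP sST) //; apply/nbrE; exists w; rewrite ?set11.
  rewrite (_ : \bigcup_(k in S) F k = setT) ?cardsT ?max_card //.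
  apply/eqP; rewrite -subTset (bigcup_max i) // /F (negbTE iT).
  exact: subxx.
pose s := perm f_inj; pose W := cycle_weight R T s.
have AbarS i : i \in T -> Abar i (s i).
  move=> iT; have := fF i; rewrite /F iT permE => /nbrE[w].
  by rewrite inE => /eqP->.
have W0 i : i \notin T -> W i = 0%R by rewrite /W /cycle_weight => /negbTE->.
pose A : 'M[R]_n :=
  (\matrix_(i, j) (W i * (j == s i)%:R + W j * (i == s j)%:R))%R.
have Areal : numerical_realization Abar A.
  apply: symmetric_numerical_realization => [|i j NAij].
    by apply/matrixP=> i j; rewrite !mxE addrC.
  have B0 x y : ~~ Abar x y -> (W x * (y == s x)%:R = 0)%R.
    move=> NA; have [xT | /W0->] := boolP (x \in T); last by rewrite mul0r.
    by case: eqP NA => [->|_ _]; [rewrite AbarS | rewrite mulr0].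
  rewrite mxE !B0 ?addr0 //; apply: contra NAij => Aji; exact/hA.
apply/eqP; rewrite eqn_leq -{1}rkA0 rank_leq_row /=.
apply: leq_trans (rk_max A Areal); rewrite mul_selection_mx row_leq_rank.
(* [u] is [v] transported along [t] and extended by zero off [T]; this extension is injective, so it
   suffices that [u] vanishes. *)
apply: inj_row_free => v; rewrite rowsubE mulmxA => uA0.
set u := (v *m _)%R in uA0.
have t_free : row_free (rowsub t (1%:M : 'M[R]_n)%R).
  by apply: row_free_rowsub => //; rewrite row_free_unit unitmx1.
apply: (row_free_inj t_free); rewrite mul0mx -/u.
apply/rowP=> x; rewrite [RHS]mxE.
apply: (@cycle_weight_inj _ _ T s (u ord0)) => [{}x xT | {}x].
  rewrite mxE big1 // => l _; rewrite !mxE.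
  case: eqP xT => [<-|]; last by rewrite mulr0.
  by rewrite hT imset_f.
(* In column [s x], the B part survives only in row [x] and the B^T part only in row [s (s x)]. *)
have /rowP/(_ (s x)) := uA0; rewrite [RHS]mxE => <-; rewrite [RHS]mxE.
under [RHS]eq_bigr => i _ do rewrite [A _ _]mxE mulrDr.
rewrite big_split /= (bigD1 x) //= eqxx mulr1 big1 => [|i neq_ix]; last first.
  by rewrite (inj_eq perm_inj) eq_sym (negbTE neq_ix) !mulr0.
rewrite addr0 (bigD1 (s (s x))) //= eqxx mulr1 big1 => [|i /negbTE->]; last first.
  by rewrite !mulr0.
by rewrite addr0 [X in (_ + X)%R]mulrC.
Qed.
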